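(* Let $A$ and $B = \{b_1 < b_2 < b_3 < \cdots\}$ be two infinite sequences of positive integers with $b_1 > 1$ such that $P(A) = \mathbb{N} \setminus B$. If $3b_1 + 5 \leq b_2 \leq 6b_1 + 10$, then $b_3 \geq b_2 + b_1 + 1$.
   Context: $\mathbb{N}$ denotes the set of all nonnegative integers. For a set $A = \{a_1 < a_2 < \cdots\}$ of positive integers, $P(A) = \{\sum \varepsilon_i a_i : a_i \in A,\ \varepsilon_i \in \{0,1\},\ \sum \varepsilon_i < \infty\}$ is the set of all finite subset sums of $A$; in particular $0 \in P(A)$ (empty sum). *)

(* Defs.v *)
From mathcomp Require Import all_boot finmap.
From mathcomp Require Import boolp classical_sets.
Set Implicit Arguments.
Unset Strict Implicit.
Unset Printing Implicit Defensive.
Local Open Scope classical_set_scope.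

Definition subset_sums (A : set nat) : set nat :=
  [set n | exists2 F : {fset nat}, [set` F] `<=` A & n = \sum_(x <- F) x].

(* Main.v *)
Require Import Defs.
From mathcomp Require Import all_boot finmap.
From mathcomp Require Import boolp classical_sets.
From mathcomp Require Import zify.
Set Implicit Arguments.
Unset Strict Implicit.
Unset Printing Implicit Defensive.
Local Open Scope classical_set_scope.

(** Write [n = b_1]. The elements of [A] below [n] have subset sums exactly
    [0, ..., n - 1], and the remaining elements [c_1 < c_2 < ...], forming [C],
    all exceed [n]; hence [P(A) = P(C) + [0, n - 1]]. Since no number other than
    [n] below [b_2] is missing, [c_1 = n + 1], [c_2 <= 2n + 1] and
    [c_3 <= c_2 + n]. Put [q = b_2 - n], which lies in [P(C)] because [b_2 - 1]
    is in [P(A)]. If [b_3 <= b_2 + n], then [P(C)] misses [q + 1, ..., q + n + 1].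
    Adding [c_1], or exchanging [c_1] for [c_2] or [c_2] for [c_3], shows that
    any subset of [C] with sum in [[q - n, q]] contains [c_1], [c_2] and [c_3].
    Comparing a subset with sum [q] to one with sum in [[q - n, q - 1]] (which
    exists because [q - 1] is in [P(A)]) forces [q > 5n + 10]. *)

(** * Subset sums as sums of duplicate-free lists *)

Definition distinct_in (C : set nat) (s : seq nat) :=
  uniq s /\ forall x, x \in s -> C x.

(** Lists replace finite sets so that adjoining and exchanging elements become [::] and [rem]. *)
Lemma subset_sumsP (A : set nat) (m : nat) :
  subset_sums A m <-> exists2 s, distinct_in A s & m = sumn s.
Proof.
split=> [[F FA ->]|[s [us sA] ->]].
  exists (enum_fset F); last by rewrite sumnE.
  by split=> [|x xF]; [exact: fset_uniq | exact: FA].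
exists [fset x in s]%fset; first by move=> x /=; rewrite inE => /sA.
rewrite sumnE; apply: perm_big; apply: uniq_perm; rewrite ?fset_uniq // => x.
by rewrite !inE.
Qed.

Lemma perm_sumn (s t : seq nat) : perm_eq s t -> sumn s = sumn t.
Proof. by move=> st; rewrite !sumnE; apply: perm_big. Qed.

Lemma sumn_rem (x : nat) (s : seq nat) : x \in s -> sumn s = x + sumn (rem x s).
Proof. by move/perm_to_rem/perm_sumn. Qed.

Lemma leq_sumn_mem (x : nat) (s : seq nat) : x \in s -> x <= sumn s.
Proof. by move/sumn_rem->; rewrite leq_addr. Qed.

Lemma leq_sumn_sub (s t : seq nat) :
  uniq s -> {subset s <= t} -> sumn s <= sumn t.
Proof.
elim: s t => [|x s IH] t //= /andP[xs us] sub.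
have xt : x \in t by apply: sub; rewrite mem_head.
rewrite (sumn_rem xt) leq_add2l; apply: IH => // y ys.
have := sub y; rewrite (perm_mem (perm_to_rem xt)) !inE ys orbT => /(_ isT).
by case: eqP => // yx; rewrite -yx ys in xs.
Qed.

Lemma distinct_in_cons (C : set nat) (x : nat) (s : seq nat) :
  C x -> distinct_in C s -> x \notin s -> distinct_in C (x :: s).
Proof.
move=> Cx [us sC] xs; split=> [|y]; first by rewrite /= xs.
by rewrite inE => /predU1P[->|/sC].
Qed.

Lemma distinct_in_rem (C : set nat) (x : nat) (s : seq nat) :
  distinct_in C s -> distinct_in C (rem x s).
Proof.
move=> [us sC]; split=> [|y]; first exact: rem_uniq.
by move/mem_rem/sC.
Qed.

Lemma mem_rem_neq (x y : nat) (s : seq nat) :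
  y \in s -> y != x -> y \in rem x s.
Proof.
move=> ys yx; have [xs|xs] := boolP (x \in s); last by rewrite rem_id.
by move: ys; rewrite (perm_mem (perm_to_rem xs)) inE (negPf yx).
Qed.

(** * Sums just below a gap of length [n.+1] *)

Section Gap.

Variables (C : set nat) (n q c2 c3 : nat).
Hypotheses (C1 : C n.+1) (C2 : C c2) (C3 : C c3).
Hypotheses (lt12 : n.+1 < c2) (le2 : c2 <= n.*2.+1).
Hypotheses (lt23 : c2 < c3) (le3 : c3 <= c2 + n).
Hypothesis C_split : forall x, C x -> [\/ x = n.+1, x = c2, x = c3 | c3 < x].
Hypothesis gap :
  forall s, distinct_in C s -> sumn s <= q \/ q + n.+1 < sumn s.

Lemma gap_swap s x y : distinct_in C s -> C y -> x \in s -> y \notin s ->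
  exists2 t, distinct_in C t /\ x \notin t & sumn t + x = sumn s + y.
Proof.
move=> ds Cy xs ys; have [us _] := ds; exists (y :: rem x s).
  split; first apply: distinct_in_cons => //; first exact: distinct_in_rem.
    by apply: contra ys; exact: mem_rem.
  rewrite inE negb_or mem_rem_uniqF // andbT.
  by apply: contraNneq ys => <-.
by rewrite (sumn_rem xs) /=; lia.
Qed.

(** Otherwise adjoining [n.+1] carries the sum past [q] but not past [q + n.+1], against [gap]. *)
Lemma gap_mem1 s : distinct_in C s -> q <= sumn s + n -> sumn s <= q ->
  n.+1 \in s.
Proof.
move=> ds h1 h2; apply: contraT => ns.
by have [] := gap (distinct_in_cons C1 ds ns) => /=; lia.
Qed.

(** Exchanging [n.+1] for [c2] raises the sum by at least 1 and at most [n]. The new sum either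
    stays at most [q], where [gap_mem1] demands the discarded [n.+1], or lands in the gap. The same
    argument, one step up, gives [gap_mem3]. *)
Lemma gap_mem2 s : distinct_in C s -> q <= sumn s + n -> sumn s <= q -> c2 \in s.
Proof.
move=> ds h1 h2; apply: contraT => ns.
have [t [dt nt] e] := gap_swap ds C2 (gap_mem1 ds h1 h2) ns.
by case: (gap dt) => h; [rewrite gap_mem1 // in nt; lia | lia].
Qed.

Lemma gap_mem3 s : distinct_in C s -> q <= sumn s + n -> sumn s <= q -> c3 \in s.
Proof.
move=> ds h1 h2; apply: contraT => ns.
have [t [dt nt] e] := gap_swap ds C3 (gap_mem2 ds h1 h2) ns.
by case: (gap dt) => h; [rewrite gap_mem2 // in nt; lia | lia].
Qed.

Lemma gap_decomp s : distinct_in C s -> q <= sumn s + n -> sumn s <= q ->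
  exists2 t, perm_eq s [:: n.+1, c2, c3 & t] & uniq t /\ forall x, x \in t -> c3 < x.
Proof.
move=> ds h1 h2; exists (rem c3 (rem c2 (rem n.+1 s))).
  apply: perm_trans (perm_to_rem (gap_mem1 ds h1 h2)) _; rewrite perm_cons.
  have m2 : c2 \in rem n.+1 s by rewrite mem_rem_neq ?gap_mem2 //; lia.
  apply: perm_trans (perm_to_rem m2) _; rewrite perm_cons.
  apply: perm_to_rem; rewrite !mem_rem_neq ?gap_mem3 //; lia.
have [us sC] := ds.
split=> [|x]; first by rewrite !rem_uniq.
rewrite !(mem_rem_uniq, inE) ?rem_uniq // => /and4P[x3 x2 x1 /sC/C_split].
by case=> // e; [move: x1|move: x2|move: x3]; rewrite e eqxx.
Qed.

Lemma gap_large s t : distinct_in C s -> sumn s = q ->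
  distinct_in C t -> q <= sumn t + n -> sumn t < q -> 5 * n + 10 < q.
Proof.
move=> ds sq dt t1 t2; rewrite ltnNge; apply/negP => qle.
have [||s' ps [us' s'3]] := gap_decomp ds; try lia.
have [||t' pt [ut' t'3]] := gap_decomp dt; try lia.
have := perm_sumn ps; have := perm_sumn pt; rewrite /= => et es.
(* After the three common elements cancel, [sumn s'] exceeds [sumn t'] by at least 1 and at most
   [n]; in particular [s'] is not empty. *)
case: s' ps us' s'3 es => [|x [|z s']] ps us' s'3 es.
- by move: es et => /=; lia.
- have x3 := s'3 x (mem_head _ _).
  case: t' pt ut' t'3 et => [|y t'] pt ut' t'3 et.
    (* An empty [t'] would force [x <= n], but [x > c3 > n]. *)
    by move: es et => /=; lia.
  have y3 := t'3 y (mem_head _ _).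
  move: es et => /= es et.
  have Cy : C y by have [_ tC] := dt; apply: tC; rewrite (perm_mem pt) !inE eqxx !orbT.
  (* Here [c3 < y <= sumn t' < x]. *)
  have ys : y \notin s by rewrite (perm_mem ps) !inE; lia.
  have m3 : c3 \in s by rewrite gap_mem3 //; lia.
  (* Exchanging [c3] for [y] must jump the whole gap, so [y > c3 + n.+1 >= 2n + 4]. Then
     [x >= 2n + 6], and [q >= (n + 1) + (n + 2) + (n + 3) + (2n + 6)] is too large. *)
  have [u [du _] e] := gap_swap ds Cy m3 ys.
  by have := gap du; lia.
(* Now [s] has five distinct elements, all at least [n + 1], so [q >= 5n + 15]. *)
- have x3 := s'3 x (mem_head _ _).
  have z3 : c3 < z by apply: s'3; rewrite !inE eqxx orbT.
  have : x != z by case/andP: us'; rewrite inE negb_or => /andP[].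
  by move: es => /=; lia.
Qed.

End Gap.

(** * The elements of [A] below the first missing sum [n] *)

Section Prefix.

Variables (a : nat -> nat) (n : nat).
Hypotheses (a_incr : {homo a : i j / i < j}) (a_pos : forall i, 0 < a i).
Hypothesis lt_sums : forall m, m < n -> subset_sums (range a) m.
Hypothesis n_sums : ~ subset_sums (range a) n.

Let prefix k := map a (iota 0 k).

Lemma prefixS k : perm_eq (prefix k.+1) (a k :: prefix k).
Proof. by rewrite /prefix -addn1 iotaD map_cat perm_catC. Qed.

Lemma mem_prefix k i : (a i \in prefix k) = (i < k).
Proof.
have a_inj : injective a.
  by move=> x y e; case: (ltngtP x y) => // /a_incr; rewrite e ltnn.
by rewrite mem_map // mem_iota.
Qed.

Lemma prefix_range k x : x \in prefix k -> range a x.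
Proof. by move/mapP => [i _ ->]; exists i. Qed.

Definition prefix_full k := forall m, m <= sumn (prefix k) ->
  exists2 s, uniq s /\ {subset s <= prefix k} & m = sumn s.

(** The intervals [[0, S]] and [[a k, a k + S]], with [S] the old sum, leave no hole between
    them. *)
Lemma prefix_fullS k :
  prefix_full k -> a k <= (sumn (prefix k)).+1 -> prefix_full k.+1.
Proof.
move=> full ak m; rewrite (perm_sumn (prefixS k)) /= => hm.
have [hk|hk] := leqP m (sumn (prefix k)).
  have [s [us ss] e] := full _ hk; exists s => //; split=> // x /ss xk.
  by rewrite (perm_mem (prefixS k)) inE xk orbT.
have [|s [us ss] e] := full (m - a k); first lia.
exists (a k :: s); last by rewrite /=; lia.
split=> /=.
  by rewrite us andbT; apply/negP => /ss; rewrite mem_prefix ltnn.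
by move=> x; rewrite (perm_mem (prefixS k)) !inE => /predU1P[->|/ss ->];
   rewrite ?eqxx ?orbT.
Qed.

Lemma prefix_full_sums k m :
  prefix_full k -> m <= sumn (prefix k) -> subset_sums (range a) m.
Proof.
move=> full /full[s [us ss] ->]; apply/subset_sumsP; exists s => //.
by split=> // x /ss/prefix_range.
Qed.

Lemma exists_full_prefix : 0 < n ->
  exists2 k, prefix_full k & (sumn (prefix k)).+1 = n.
Proof.
move=> n0.
(* The bound [k <= sumn (prefix k)] ends the search: at [k = n] the second alternative is absurd. *)
suff H k : (exists2 k, prefix_full k & (sumn (prefix k)).+1 = n) \/
    [/\ prefix_full k, (sumn (prefix k)).+1 < n & k <= sumn (prefix k)].
  by have [//|[_]] := H n; lia.
elim: k => [|k [|[full lt kle]]]; [|by left|].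
  have full0 : prefix_full 0.
    by move=> m; rewrite leqn0 => /eqP->; exists [::].
  have [n1|n1] := eqVneq 1 n; first by left; exists 0.
  by right; split=> //=; lia.
(* If [a k] were larger, only prefix elements could be used to form [(sumn (prefix k)).+1], and
   their total is too small. *)
have ak : a k <= (sumn (prefix k)).+1.
  have /subset_sumsP[s [us sA] e] := lt_sums lt.
  rewrite leqNgt; apply/negP => lak.
  suff : sumn s <= sumn (prefix k) by rewrite -e ltnn.
  apply: leq_sumn_sub => // x xs; have [i _ ei] := sA _ xs.
  rewrite -ei mem_prefix ltnNge; apply/negP => ki.
  have := leq_sumn_mem xs; rewrite -e -ei.
  have : a k <= a i.
    by move: ki; rewrite leq_eqVlt => /predU1P[->//|/a_incr/ltnW].
  lia.
have fullS := prefix_fullS full ak.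
have eS : sumn (prefix k.+1) = a k + sumn (prefix k) := perm_sumn (prefixS k).
have ltS : sumn (prefix k.+1) < n.
  by rewrite ltnNge; apply/negP => h; apply: n_sums; apply: prefix_full_sums h.
have := a_pos k.
have [e|ne] := eqVneq (sumn (prefix k.+1)).+1 n; first by left; exists k.+1.
by right; split=> //; lia.
Qed.

Lemma subset_sums_split : 0 < n -> exists k,
  (forall i, k <= i -> n < a i) /\
  forall m, subset_sums (range a) m <->
    exists s r, [/\ distinct_in [set a i | i in [set i | k <= i]] s, r < n
                 & m = sumn s + r].
Proof.
move=> n0; have [k full en] := exists_full_prefix n0.
exists k.
(* Otherwise the prefix supplies [n - a i], and adjoining [a i] makes [n] a subset sum. *)
have gtn i : k <= i -> n < a i.
  move=> ki; rewrite ltnNge; apply/negP => ain.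
  have [|s [us ss] e] := full (n - a i); first by have := a_pos i; lia.
  apply: n_sums; apply/subset_sumsP; exists (a i :: s); last by rewrite /=; lia.
  apply: distinct_in_cons; first by exists i.
    by split=> // x /ss/prefix_range.
  by apply/negP => /ss; rewrite mem_prefix; lia.
split=> // m; split=> [/subset_sumsP[s [us sA] ->]|[s [r [[us sC] rn ->]]]].
  pose l := [seq x <- s | x \in prefix k]; pose h := [seq x <- s | x \notin prefix k].
  exists h, (sumn l); split.
  - split=> [|x]; first exact: filter_uniq.
    rewrite mem_filter => /andP[xk /sA[i _ ei]]; exists i => //=.
    by rewrite leqNgt -mem_prefix ei.
  - rewrite -en ltnS; apply: leq_sumn_sub; first exact: filter_uniq.
    by move=> x; rewrite mem_filter => /andP[].
  - by rewrite addnC -sumn_cat; apply: perm_sumn; rewrite perm_sym (perm_filterC _ s).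
have [|t [ut tt] ->] := full r; first lia.
apply/subset_sumsP; exists (s ++ t); last by rewrite sumn_cat.
split.
  rewrite cat_uniq us ut andbT /=; apply/hasPn => x /tt xk.
  by apply/negP => /sC[i /= ki ei]; move: xk; rewrite -ei mem_prefix; lia.
move=> x; rewrite mem_cat => /orP[/sC[i _ <-]|/tt/prefix_range//].
by exists i.
Qed.

End Prefix.

(* Indexing is from 0: the paper's b_1, b_2, b_3 are b 0, b 1, b 2. *)
Theorem theorem1p1 (a b : nat -> nat)
  (a_incr : {homo a : i j / i < j}) (a_pos : forall i, 0 < a i)
  (b_incr : {homo b : i j / i < j}) (b_pos : forall i, 0 < b i)
  (b1_gt1 : 1 < b 0)
  (PA_eq : subset_sums (range a) = ~` range b)
  (b2_ge : 3 * b 0 + 5 <= b 1) (b2_le : b 1 <= 6 * b 0 + 10) :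
  b 1 + b 0 + 1 <= b 2.
Proof.
have PA m : subset_sums (range a) m <-> ~ range b m by rewrite PA_eq.
have b_le i j : i <= j -> b i <= b j.
  by rewrite leq_eqVlt => /predU1P[->//|/b_incr/ltnW].
have b_notin i : ~ subset_sums (range a) (b i) by move/PA; apply; exists i.
have lt0_sums m : m < b 0 -> subset_sums (range a) m.
  by move=> lt; apply/PA => -[i _ e]; have := b_le 0 i isT; lia.
have lt1_sums m : m != b 0 -> m < b 1 -> subset_sums (range a) m.
  move=> ne lt; apply/PA => -[[|i] _ e]; first by rewrite e eqxx in ne.
  by have := b_le 1 i.+1 isT; lia.
have [|k [gtn split]] :=
  subset_sums_split a_incr a_pos lt0_sums (b_notin 0); first lia.
set C := (X in distinct_in X) in split.
set n := b 0 in b1_gt1 b2_ge b2_le lt0_sums lt1_sums gtn split *.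
have CE i : k <= i -> C (a i) by move=> ki; exists i.
have a_lt i j : i < j -> a i < a j by exact: a_incr.
have cover m : m != n -> m < b 1 ->
    exists s r, [/\ distinct_in C s, r < n & m = sumn s + r].
  by move=> ne lt; apply/split/lt1_sums.
have C_split x : C x -> [\/ x = a k, x = a k.+1, x = a k.+2 | a k.+2 < x].
  move=> [i /= ki <-].
  have [->|n0] := eqVneq i k; first by constructor 1.
  have [->|n1] := eqVneq i k.+1; first by constructor 2.
  have [->|n2] := eqVneq i k.+2; first by constructor 3.
  by constructor 4; apply: a_lt; lia.
have ak_gt := gtn k (leqnn k).
have a12 := a_lt k k.+1 (leqnn _).
have a23 := a_lt k.+1 k.+2 (leqnn _).
(* In the next three claims the remainder [r] is at most [n - 1], so the chosen target needs a sum
   from [C] greater than [0], [n.+1] and [a k.+1] respectively. Two distinct elements already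
   overshoot, unless the claimed bound holds. *)
have c1E : a k = n.+1.
  have [||s [r [[us sC] rn e]]] := cover n.+1; [lia|lia|].
  case: s us sC e => [|x s] us sC /= e; first lia.
  have := sC x (mem_head _ _) => /C_split[]; lia.
rewrite c1E in a12 C_split.
have le2 : a k.+1 <= n.*2.+1.
  have [||s [r [[us sC] rn e]]] := cover n.*2.+1; [lia|lia|].
  case: s us sC e => [|x [|y s]] us sC /= e; first lia.
    have := sC x (mem_head _ _) => /C_split[]; lia.
  have := sC x (mem_head _ _) => /C_split hx.
  have : C y by apply: sC; rewrite !inE eqxx orbT.
  by move/C_split; case: hx => ?; case=> ?; lia.
have le3 : a k.+2 <= a k.+1 + n.
  have [||s [r [[us sC] rn e]]] := cover (a k.+1 + n); [lia|lia|].
  rewrite leqNgt; apply/negP => lt.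
  case: s us sC e => [|x [|y s]] us sC /= e; first lia.
    have := sC x (mem_head _ _) => /C_split[]; lia.
  have := sC x (mem_head _ _) => /C_split hx.
  have : C y by apply: sC; rewrite !inE eqxx orbT.
  have xy : x != y by case/andP: us; rewrite inE negb_or => /andP[].
  by move/C_split; case: hx => ?; case=> ?; lia.
have b12 : b 1 < b 2 by exact: b_incr.
rewrite leqNgt; apply/negP => b3_lt.
(* A sum in [[b 1 - n + 1, b 1]] would reach [b 1] with a remainder below [n]; the one further value
   [b 1 + 1] would likewise reach [b 2]. *)
have gap s : distinct_in C s -> sumn s <= b 1 - n \/ b 1 - n + n.+1 < sumn s.
  move=> ds; have [|h1] := leqP (sumn s) (b 1 - n); first by left.
  right; rewrite ltnNge; apply/negP => h2.
  have [h|h] := leqP (sumn s) (b 1).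
    by apply: (b_notin 1); apply/split; exists s, (b 1 - sumn s); split=> //; lia.
  by apply: (b_notin 2); apply/split; exists s, (b 2 - sumn s); split=> //; lia.
have C1 : C n.+1 by rewrite -c1E; exact: CE.
(* Here [sumn s] lies in [[b 1 - n, b 1 - 1]], so [gap] leaves only [b 1 - n]. Next, [sumn t] lies
   within [n] below that value. *)
have [||s [r [ds rn es]]] := cover (b 1).-1; [lia|lia|].
have [||t [r' [dt rn' et]]] := cover (b 1 - n).-1; [lia|lia|].
have [C2 C3] : C (a k.+1) /\ C (a k.+2) by split; apply: CE; lia.
suff : 5 * n + 10 < b 1 - n by lia.
have gs := gap s ds; have gt := gap t dt.
by apply: (gap_large C1 C2 C3 a12 le2 a23 le3 C_split gap ds _ dt); lia.
Qed.
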